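(* Let $s, t \in \mathbb{N}$ with $2 \leq s \leq t$. Then $\mathrm{ex}(n, K_3, K_{1,s,t}) = O\left(n^{3-1/s} (\log n)^{-1+1/s}\right)$, where the implicit constant depends on $s$ and $t$. That is, there exists a constant $C > 0$ depending only on $s$ and $t$ such that for every integer $n \geq 2$, every $K_{1,s,t}$-free graph on $n$ vertices contains at most $C\, n^{3-1/s} (\log n)^{-1+1/s}$ triangles.
   Context: Graphs are finite and simple. For graphs $T$ and $H$, the generalized Turán number $\mathrm{ex}(n, T, H)$ is the maximum number of copies of $T$ (as not necessarily induced subgraphs) in an $H$-free graph on $n$ vertices, where a graph is $H$-free if it contains no (not necessarily induced) subgraph isomorphic to $H$. $K_3$ is the triangle; $K_{1,s,t}$ is the complete tripartite graph with parts of sizes $1$, $s$ and $t$. $\log$ denotes the natural logarithm. *)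

(* Defs.v *)
From HB Require Import structures.
From mathcomp Require Import all_boot all_order all_algebra.
From mathcomp Require Import all_reals exp.

Set Implicit Arguments.
Unset Strict Implicit.
Unset Printing Implicit Defensive.

(* A finite simple graph on V is given by its edges, each a set of exactly two
   vertices. *)
Definition simple_edges (V : finType) (E : {set {set V}}) : bool :=
  [forall e in E, #|e| == 2].

Record sgraph (V : finType) := SGraph {
  edges :> {set {set V}};
  edgesP : simple_edges edges }.

HB.instance Definition _ (V : finType) := [isSub for @edges V].
HB.instance Definition _ (V : finType) := [Finite of sgraph V by <:].

(* A pair P = (W, F) stands for the graph with vertex set W and edge set F. *)
Definition is_subgraph (V : finType) (P : {set V} * {set {set V}})
    (G : sgraph V) : bool :=
  (P.2 \subset edges G) && [forall e in P.2, e \subset P.1].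

Definition isomorphic_to (U V : finType) (P : {set V} * {set {set V}})
    (T : sgraph U) : bool :=
  [exists f : {ffun U -> V},
    [&& injectiveb f, P.1 == f @: [set: U] &
        P.2 == [set f @: (e : {set U}) | e in edges T]]].

(* Copies are unlabelled: they are subgraphs, not embeddings. *)
Definition copies (U V : finType) (T : sgraph U) (G : sgraph V) :
    {set {set V} * {set {set V}}} :=
  [set P | is_subgraph P G && isomorphic_to P T].

Definition subgraph_free (U V : finType) (H : sgraph U) (G : sgraph V) : bool :=
  copies H G == set0.

Definition turan_ex (n : nat) (U W : finType) (T : sgraph U) (H : sgraph W) : nat :=
  \max_(G : sgraph 'I_n | subgraph_free H G) #|copies T G|.

Definition join_edges (V : finType) (r : rel V) : {set {set V}} :=
  [set [set p.1; p.2] | p : V * V & (p.1 != p.2) && r p.1 p.2].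

Lemma join_edges_simple (V : finType) (r : rel V) : simple_edges (join_edges r).
Proof.
apply/forall_inP => e /imsetP[[x y]]; rewrite inE /= => /andP[xy _] ->.
by rewrite cards2 xy.
Qed.

Definition graph_of_rel (V : finType) (r : rel V) : sgraph V :=
  SGraph (join_edges_simple r).

Definition complete_graph (n : nat) : sgraph 'I_n :=
  graph_of_rel (fun _ _ => true).

Definition tripart (a b c : nat) (x : 'I_a + 'I_b + 'I_c) : nat :=
  match x with inl (inl _) => 0 | inl (inr _) => 1 | inr _ => 2 end.

Definition complete_tripartite (a b c : nat) :
    sgraph ('I_a + 'I_b + 'I_c)%type :=
  graph_of_rel (fun x y => tripart x != tripart y).

Definition map_pair (V V' : finType) (g : V -> V') (P : {set V} * {set {set V}}) :
    {set V'} * {set {set V'}} :=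
  (g @: P.1, [set g @: (e : {set V}) | e in P.2]).

Lemma map_edges_simple (V V' : finType) (g : V -> V') (g' : V' -> V)
    (gK : cancel g g') (G : sgraph V) :
  simple_edges [set g @: (e : {set V}) | e in edges G].
Proof.
apply/forall_inP => e /imsetP[e0 e0G ->].
rewrite card_imset; last exact: can_inj gK.
exact: (forall_inP (edgesP G)).
Qed.

Definition map_graph (V V' : finType) (g : V -> V') (g' : V' -> V)
    (gK : cancel g g') (G : sgraph V) :
    sgraph V' :=
  SGraph (map_edges_simple gK G).

Lemma map_pair_copies (V V' : finType) (g : V -> V') (g' : V' -> V)
    (gK : cancel g g') (U : finType) (T : sgraph U)
    (G : sgraph V) P :
  P \in copies T G -> map_pair g P \in copies T (map_graph gK G).
Proof.
rewrite !inE => /andP[/andP[sub /forall_inP inc] /existsP[f]].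
move=> /and3P[/injectiveP finj /eqP P1 /eqP P2].
apply/andP; split; [apply/andP; split|].
- exact: imsetS.
- by apply/forall_inP => e /imsetP[e0 /inc e0P ->]; exact: imsetS.
apply/existsP; exists [ffun u => g (f u)].
have fE (A : {set U}) : [ffun u => g (f u)] @: A = g @: (f @: A).
  by rewrite -imset_comp; apply: eq_imset => u; rewrite ffunE.
apply/and3P; split.
- apply/injectiveP => u v; rewrite !ffunE => /(can_inj gK); exact: finj.
- by rewrite /= fE P1.
- rewrite /= P2 -imset_comp; apply/eqP; apply: eq_imset => A /=.
  by rewrite fE.
Qed.

Lemma map_pairK (V V' : finType) (g : V -> V') (g' : V' -> V) :
  cancel g g' -> cancel (map_pair g) (map_pair g').
Proof.
move=> gK [W F]; have iK (A : {set V}) : g' @: (g @: A) = A.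
  by rewrite -imset_comp (eq_imset _ gK) imset_id.
rewrite /map_pair /= iK; congr pair.
by rewrite -imset_comp (eq_imset _ iK) imset_id.
Qed.

Lemma map_graphK (V V' : finType) (g : V -> V') (g' : V' -> V)
    (gK : cancel g g') (g'K : cancel g' g) (G : sgraph V) :
  map_graph g'K (map_graph gK G) = G.
Proof.
by apply: val_inj; have [] := map_pairK gK (set0, edges G).
Qed.

(* Taking 'I_n as the vertex set in turan_ex loses no generality. *)
Lemma copies_le_turan_ex (n : nat) (U W V : finType) (T : sgraph U) (H : sgraph W)
    (G : sgraph V) :
  #|V| = n -> subgraph_free H G -> #|copies T G| <= turan_ex n T H.
Proof.
move=> <- HG; rewrite /turan_ex.
have gK := @enum_rankK V; have g'K := @enum_valK V.
have HG' : subgraph_free H (map_graph gK G).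
  apply/eqP/setP => P; rewrite in_set0; apply/negP => /(map_pair_copies g'K).
  by rewrite map_graphK (eqP HG) in_set0.
apply: leq_trans (leq_bigmax_cond _ HG').
rewrite -(card_imset _ (can_inj (map_pairK gK))).
by apply/subset_leq_card/subsetP => P /imsetP[Q QG ->]; apply: map_pair_copies.
Qed.

(* Main.v *)
Require Import Defs.
From mathcomp Require Import all_boot all_order all_algebra.
From mathcomp Require Import all_reals exp.
From mathcomp Require Import zify ring lra.
Import Order.TTheory GRing.Theory Num.Theory.
Local Open Scope ring_scope.

Set Implicit Arguments.
Unset Strict Implicit.
Unset Printing Implicit Defensive.

(** In a graph G free of K_{1,s,t}, a star with s leaves has fewer than t
    common neighbours. Applied to stars centred at a, this makes the link of a
    free of K_{s,t}, hence of size O(n^(2-1/s)), and summing over a already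
    gives O(n^(3-1/s)) triangles. The logarithm is gained by letting the link
    of almost every a be much sparser than that.

    Take a set W of at most r probes, r of order log n. Colour each vertex x by
    its trace W n N(x): there are only 2^r colours, a small power of n. An edge
    xy of the link of a is of one of two kinds.
    - x and y have s - 1 common neighbours Q in W. For a outside W, the star
      centred at x with leaves a and Q has at most t common neighbours, one of
      which is y, so there are at most 2^r n t such edges
      (card_link_probed).
    - x and y have fewer than s - 1 common neighbours in W. For x in a given
      colour class X, the possible y form a set Y that depends only on that
      class, and the Kovari-Sos-Turan bound applies to each pair (X, Y)
      (kst_linear). The union of the products X * Y is the set of pairs of
      neighbours of a that are still covered at most s - 2 times by the sets
      N(w) * N(w), w in W (card_link_unprobed).

    The probes can be chosen so that, for every a outside W, this last set has
    at most (s - 1) n^2 / r elements: otherwise adding a to W would improve the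
    (s - 1)-fold covering of V * V too much, and this cannot happen more than r
    times (exists_multicover). The product X * Y is thus sparser by a factor r
    than the trivial bound n^2, and the Kovari-Sos-Turan exponent turns it into
    a factor r^(1-1/s) in the number of edges. With 16^r about n, the
    contributions of the order 2^r are negligible. *)

(** * A linear form of the Kovari-Sos-Turan bound *)

Lemma expn_le_ffact (d k : nat) : ((d - k) ^ k.+1 <= d ^_ k.+1)%N.
Proof.
elim: k d => [|k IHk] d; first by rewrite subn0 expn1 ffactn1.
case: d => [|d]; first by rewrite sub0n exp0n.
rewrite ffactSS subSS expnS leq_mul //.
by rewrite (leq_trans (leq_subr _ _)).
Qed.

Lemma ffact_le_expn (d k : nat) : (d ^_ k <= d ^ k)%N.
Proof.
elim: k d => [|k IHk] [|d] //.
rewrite ffactSS expnS leq_mul2l /=; apply: leq_trans (IHk d) _.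
by case: k {IHk} => [|k]; rewrite ?expn0 ?leq_exp2r ?leqnSn.
Qed.

(** A linear substitute for the convexity of the falling factorial: either
    d - k <= M, or ((d - k) / M)^k >= 1 and the last term dominates d - k. The
    parameter M is left free, so that the bounds for many classes can be added
    up. *)
Lemma le_ffact_linear (R : realFieldType) (k d : nat) (M : R) : 0 < M ->
  d%:R <= k%:R + M + (d ^_ k.+1)%:R / M ^+ k.
Proof.
move=> M0; have Mk : 0 < M ^+ k by exact: exprn_gt0.
have F0 : 0 <= (d ^_ k.+1)%:R / M ^+ k by rewrite divr_ge0 ?ler0n ?ltW.
have dk : d%:R <= k%:R + (d - k)%:R :> R by rewrite -natrD ler_nat -leq_subLR.
have [le_M|lt_M] := leP (d - k)%:R M; first by lra.
suff : (d - k)%:R <= (d ^_ k.+1)%:R / M ^+ k by lra.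
rewrite ler_pdivlMr //.
apply: (@le_trans _ _ ((d - k) ^ k.+1)%:R); last by rewrite ler_nat expn_le_ffact.
rewrite natrX exprS ler_wpM2l ?ler0n //.
by rewrite lerXn2r ?nnegrE ?ler0n // ltW.
Qed.

Lemma card_columns (T U : finType) (A : {set T * U}) :
  #|A| = (\sum_y #|[set x | (x, y) \in A]|)%N.
Proof.
rewrite -sum1_card.
transitivity (\sum_y \sum_(x | (x, y) \in A) 1)%N; last first.
  by apply: eq_bigr => y _; rewrite sum1dep_card.
rewrite (exchange_big_dep xpredT) //= pair_big_dep /=.
by apply: eq_bigl => -[].
Qed.

(** Stars with k + 1 leaves in X and centre in Y are counted twice: by their
    centres, using le_ffact_linear with M = nu |X|, and by their leaves. Taking
    M proportional to |X| makes the bound linear in |X| and in |X| |Y|, with the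
    same nu whatever X and Y. Hence it can be summed over the colour classes and
    optimised in nu only once, which replaces the use of the inequality of
    Holder. *)
Lemma kst_linear (R : realFieldType) (V : finType) (e : rel V) (k t : nat)
    (X Y : {set V}) (nu : R) :
    0 < nu ->
    (forall S : {set V}, S \subset X -> #|S| = k.+1 ->
      (#|[set y in Y | S \subset [set x | e x y]]| <= t)%N) ->
  #|[set p : V * V | [&& p.1 \in X, p.2 \in Y & e p.1 p.2]]|%:R <=
    k%:R * #|Y|%:R + nu * (#|X| * #|Y|)%:R + t%:R * #|X|%:R / nu ^+ k.
Proof.
move=> nu0 codeg.
pose d y := #|[set x in X | e x y]|.
have -> : #|[set p : V * V | [&& p.1 \in X, p.2 \in Y & e p.1 p.2]]|
    = (\sum_(y in Y) d y)%N.
  rewrite card_columns [RHS]big_mkcond /=; apply: eq_bigr => y _.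
  case: ifPn => yY; last first.
    by apply/eqP; rewrite cards_eq0; apply/eqP/setP => x; rewrite !inE (negPf yY) andbF.
  by apply: eq_card => x; rewrite !inE yY.
have [X0|X0] := posnP #|X|.
  rewrite big1 ?X0 ?mul0n ?mulr0 ?mul0r ?addr0 ?mulr_ge0 // => y _.
  apply/eqP; rewrite -leqn0 -X0; apply/subset_leq_card/subsetP => x.
  by rewrite inE => /andP[].
have XR : 0 < #|X|%:R :> R by rewrite ltr0n.
have stars : (\sum_(y in Y) d y ^_ k.+1 <= t * #|X| ^ k.+1)%N.
  have cnt : (\sum_(y in Y) 'C(d y, k.+1) <= t * 'C(#|X|, k.+1))%N.
    rewrite -(cards_draws X k.+1) mulnC -sum_nat_const.
    rewrite (eq_bigr (fun y => \sum_(S : {set V} |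
        (S \subset [set x in X | e x y]) && (#|S| == k.+1)) 1)%N); last first.
      by move=> y _; rewrite -cards_draws sum1dep_card.
    rewrite (exchange_big_dep
      (fun S : {set V} => (S \subset X) && (#|S| == k.+1))) /=; last first.
      move=> y S _ /andP[/subset_trans sub ->]; rewrite andbT sub //.
      by apply/subsetP => x; rewrite inE => /andP[].
    rewrite [leqRHS](eq_bigl
      (fun S : {set V} => (S \subset X) && (#|S| == k.+1))); last first.
      by move=> S; rewrite inE.
    apply: leq_sum => S /andP[SX /eqP Sk]; apply: leq_trans (codeg S SX Sk).
    rewrite sum1_card; apply/subset_leq_card/subsetP => y.
    rewrite !inE => /andP[-> /andP[/subsetP sub _]] /=.
    by apply/subsetP => x /sub; rewrite !inE => /andP[].
  under eq_bigr do rewrite -bin_ffact.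
  rewrite -big_distrl /=; apply: leq_trans (leq_mul cnt (leqnn _)) _.
  by rewrite -mulnA bin_ffact leq_mul2l ffact_le_expn orbT.
rewrite natr_sum.
have M0 : 0 < nu * #|X|%:R by rewrite mulr_gt0.
apply: le_trans (ler_sum _ (fun y _ => le_ffact_linear k (d y) M0)) _.
rewrite !big_split /= !sumr_const -mulr_suml -natr_sum -[k%:R *+ _]mulr_natr -[(nu * _) *+ _]mulr_natr.
rewrite [(#|X| * _)%:R]natrM mulrA lerD2l ler_pdivrMr ?exprn_gt0 //.
apply: (@le_trans _ _ (t * #|X| ^ k.+1)%:R); first by rewrite ler_nat.
rewrite exprMn natrM natrX exprS le_eqVlt; apply/orP; left; apply/eqP.
by field; rewrite expf_neq0 // gt_eqF.
Qed.

(** * Probes *)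

(** W maximises a trade-off between the k-fold coverage Phi, at most c = k |P|,
    and the price c / r of each element. Being at least as good as the empty
    set, W costs at most c, that is |W| <= r; and no further element is worth
    its price, which is the second conclusion. *)
Lemma exists_multicover (V P : finType) (F : V -> {set P}) (k r : nat) :
  exists W : {set V}, (#|W| <= r)%N /\ forall a, a \notin W ->
    (r * #|[set p in F a | #|[set w in W | p \in F w]| < k]| <= k * #|P|)%N.
Proof.
have [/eqP|c0] := posnP (k * #|P|)%N.
  move=> kP0; exists set0; split => [|a _]; first by rewrite cards0.
  rewrite (eqP kP0) leqn0 muln_eq0 cards_eq0; apply/orP; right.
  apply/eqP/setP => p; rewrite !inE; apply/negP => /andP[_].
  move: kP0; rewrite muln_eq0 => /orP[/eqP->|]; first by rewrite ltn0.
  by rewrite -leqn0 leqNgt => /negP[]; apply/card_gt0P; exists p.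
set c := (k * #|P|)%N in c0 *.
pose cov (W : {set V}) p := #|[set w in W | p \in F w]|.
pose Phi W := (\sum_p minn (cov W p) k)%N.
(* The score is multiplied by r and shifted by |V| c to remain in nat. *)
pose score (W : {set V}) := (r * Phi W + (#|V| - #|W|) * c)%N.
have [W _ Wmax] := @arg_maxnP _ set0 xpredT score isT.
exists W; split.
  have := Wmax set0 isT; rewrite /score cards0 subn0.
  have PhiW : (Phi W <= c)%N.
    rewrite /c mulnC -sum_nat_const; apply: leq_sum => p _; exact: geq_minr.
  have WV : (#|W| <= #|V|)%N := max_card _.
  rewrite -(leq_pmul2r c0); nia.
move=> a aW; have aWV : (#|W| < #|V|)%N.
  by have := max_card (mem (a |: W)); rewrite cardsU1 aW.
have step : Phi (a |: W) = (#|[set p in F a | cov W p < k]| + Phi W)%N.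
  rewrite -sum1dep_card big_mkcond -big_split; apply: eq_bigr => p _ /=.
  suff -> : cov (a |: W) p = ((p \in F a) + cov W p)%N.
    by case: (p \in F a); rewrite /= ?add0n //; case: (ltnP (cov W p) k); lia.
  rewrite /cov; have [aF|aF] := boolP (p \in F a).
    have -> : [set w in a |: W | p \in F w] = a |: [set w in W | p \in F w].
      by apply/setP => w; rewrite !inE; case: eqP => [->|].
    by rewrite cardsU1 inE (negPf aW).
  by apply: eq_card => w; rewrite !inE; case: eqP => [->|//]; rewrite (negPf aF) !andbF.
have := Wmax (a |: W) isT; rewrite /score step cardsU1 aW /cov; nia.
Qed.

Definition nbr (V : finType) (e : rel V) (x : V) : {set V} := [set y | e x y].

Definition link (V : finType) (e : rel V) (a : V) : {set V * V} :=
  [set p | [&& e a p.1, e a p.2 & e p.1 p.2]].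

(** Stated with p \in N(w) * N(w), so that it is the multiplicity in
    exists_multicover. *)
Definition probes (V : finType) (e : rel V) (W : {set V}) (p : V * V) : {set V} :=
  [set w in W | p \in setX (nbr e w) (nbr e w)].

Lemma card_le_sum (I T : finType) (A : {set T}) (D : {set I}) (B : I -> {set T}) :
    (forall x, x \in A -> exists2 i, i \in D & x \in B i) ->
  (#|A| <= \sum_(i in D) #|B i|)%N.
Proof.
move=> AB; apply: (@leq_trans #|\bigcup_(i in D) B i|); last first.
  elim/big_ind2: _ => [|m S m' S' le_m le_m'|i _ //]; first by rewrite cards0.
  by rewrite (leq_trans (leq_card_setU S S')) // leq_add.
by apply/subset_leq_card/subsetP => x /AB[i iD xB]; apply/bigcupP; exists i.
Qed.

(** * The link of a vertex outside the probes *)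

(** If Q is a set of k probes adjacent to both x and y, then the star centred at
    y with the k + 1 leaves a and Q has x as a common neighbour. That a is not a
    probe guarantees that the leaves are distinct. *)
Lemma card_link_probed (V : finType) (e : rel V) (k t : nat)
    (W : {set V}) (a : V) :
    symmetric e ->
    (forall (c : V) (S : {set V}), S \subset nbr e c -> #|S| = k.+1 ->
      (#|[set y in nbr e c | S \subset nbr e y]| <= t)%N) ->
    a \notin W ->
  (#|[set p in link e a | (k <= #|probes e W p|)%N]| <= 2 ^ #|W| * (#|V| * t))%N.
Proof.
move=> e_sym codeg aW.
pose B (Q : {set V}) := [set p in link e a |
  [&& Q \subset W, #|Q| == k, Q \subset nbr e p.1 & Q \subset nbr e p.2]].
apply: (@leq_trans (\sum_(Q in powerset W) #|B Q|)).
  apply: card_le_sum => p; rewrite inE -bin_gt0 -cards_draws.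
  move=> /andP[pa /card_gt0P[Q]]; rewrite inE => /andP[/subsetP Qp Qk].
  have QW : Q \subset W by apply/subsetP => w /Qp; rewrite inE => /andP[].
  exists Q; first by rewrite inE.
  rewrite inE pa QW Qk /=.
  by apply/andP; split; apply/subsetP => w /Qp; rewrite !inE (e_sym _ w) => /and3P[].
rewrite -card_powerset -sum_nat_const; apply: leq_sum => Q.
rewrite inE => QW.
rewrite card_columns -sum_nat_const; apply: leq_sum => y _.
have [/and3P[ay /eqP Qk Qy]|Qy] := boolP [&& e a y, #|Q| == k & Q \subset nbr e y].
  have aQ : a \notin Q by apply: contra aW; apply: (subsetP QW).
  have := codeg y (a |: Q); rewrite cardsU1 aQ Qk subUset Qy sub1set inE e_sym ay.
  move=> /(_ isT erefl); apply: leq_trans; apply/subset_leq_card/subsetP => x.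
  rewrite !inE subUset sub1set inE.
  by case/and5P=> /and3P[ax _ xy] _ _ Qx _; rewrite e_sym xy e_sym ax.
apply: (@leq_trans 0); rewrite // leqn0 cards_eq0; apply/eqP/setP => x; rewrite !inE.
by apply: contraNF Qy => /and5P[/and3P[_ -> _] _ -> _ ->].
Qed.

(** The pairs are sorted by the colour P = W n N(x) of their first component:
    the probes adjacent to both x and y are the elements of P adjacent to y. The
    products X P * Y P of the classes partition the set of all poorly probed
    pairs of neighbours of a, so its cardinal appears in the sum of the bounds
    of kst_linear. *)
Lemma card_link_unprobed (R : realFieldType) (V : finType) (e : rel V)
    (k t : nat) (W : {set V}) (a : V) (nu : R) :
    symmetric e ->
    (forall (c : V) (S : {set V}), S \subset nbr e c -> #|S| = k.+1 ->
      (#|[set y in nbr e c | S \subset nbr e y]| <= t)%N) ->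
    0 < nu ->
  #|[set p in link e a | (#|probes e W p| < k)%N]|%:R <=
    (2 ^ #|W| * (k * #|V|))%:R
    + nu * #|[set p in setX (nbr e a) (nbr e a) | (#|probes e W p| < k)%N]|%:R
    + t%:R * #|V|%:R / nu ^+ k.
Proof.
move=> e_sym codeg nu0.
pose X P := [set x in nbr e a | W :&: nbr e x == P].
pose Y (P : {set V}) := [set y in nbr e a | (#|P :&: nbr e y| < k)%N].
have probesE p : probes e W p = (W :&: nbr e p.1) :&: nbr e p.2.
  by apply/setP => w; rewrite !inE andbA !(e_sym w).
have splitX (A : {set V * V}) : (#|A| = \sum_(P in powerset W)
    #|[set p in A | W :&: nbr e p.1 == P]|)%N.
  rewrite -sum1_card (partition_big (fun p => W :&: nbr e p.1)
    (fun P => P \in powerset W)) /=; last by move=> p _; rewrite inE subsetIl.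
  by apply: eq_bigr => P _; rewrite sum1dep_card; apply: eq_card => p; rewrite !inE.
have classX P : [set p in [set p in link e a | (#|probes e W p| < k)%N]
      | W :&: nbr e p.1 == P]
    = [set p | [&& p.1 \in X P, p.2 \in Y P & e p.1 p.2]].
  apply/setP => p; rewrite !inE probesE.
  by case: eqP => [->|_]; rewrite ?andbT ?andbF //=;
    case: (e a p.1); case: (e a p.2); case: (e p.1 p.2); rewrite //= ?andbT ?andbF.
have classY P : [set p in [set p in setX (nbr e a) (nbr e a) | (#|probes e W p| < k)%N]
      | W :&: nbr e p.1 == P]
    = setX (X P) (Y P).
  apply/setP => p; rewrite !inE probesE.
  by case: eqP => [->|_]; rewrite ?andbT ?andbF //=;
    case: (e a p.1); case: (e a p.2); rewrite //= ?andbT ?andbF.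
rewrite [in leLHS]splitX [in leRHS]splitX !natr_sum.
under eq_bigr do rewrite classX.
under [in leRHS]eq_bigr do rewrite classY cardsX.
have sumX : (\sum_(P in powerset W) #|X P| <= #|V|)%N.
  rewrite (leq_trans _ (max_card (mem (nbr e a)))) //.
  rewrite -[leqRHS]sum1_card (partition_big (fun x => W :&: nbr e x)
    (fun P => P \in powerset W)) /=; last by move=> p _; rewrite inE subsetIl.
  by apply: leq_sum => P _; rewrite sum1dep_card.
have kst P : #|[set p | [&& p.1 \in X P, p.2 \in Y P & e p.1 p.2]]|%:R <=
    k%:R * #|V|%:R + nu * (#|X P| * #|Y P|)%:R + t%:R * #|X P|%:R / nu ^+ k.
  apply: (@le_trans _ _ (k%:R * #|Y P|%:R + nu * (#|X P| * #|Y P|)%:R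
                         + t%:R * #|X P|%:R / nu ^+ k)); last first.
    by rewrite !lerD2r ler_wpM2l ?ler0n // ler_nat max_card.
  apply: kst_linear => // S SX Sk.
  have Sa : S \subset nbr e a.
    by apply: subset_trans SX _; apply/subsetP => x; rewrite inE => /andP[].
  apply: leq_trans (codeg a S Sa Sk); apply/subset_leq_card/subsetP => y.
  rewrite !inE => /andP[/andP[-> _] /subsetP sub] /=.
  by apply/subsetP => x /sub; rewrite !inE e_sym.
apply: le_trans (ler_sum _ (fun P _ => kst P)) _.
rewrite !big_split /= sumr_const card_powerset -mulr_sumr lerD //.
  by rewrite lerD2r -natrM -mulrnA mulnC.
rewrite -mulr_suml -mulr_sumr -natr_sum ler_pM2r ?invr_gt0 ?exprn_gt0 //.
by rewrite ler_wpM2l ?ler0n // ler_nat.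
Qed.

(** * Counting triangles *)

(** The links of the probes are bounded trivially by n^2 each, and there are at
    most r <= 2^r of them: this is the 1 in t + k + 1. *)
Lemma triangle_sum_le (R : realFieldType) (V : finType) (e : rel V)
    (k t r : nat) (nu : R) :
    symmetric e ->
    (forall (c : V) (S : {set V}), S \subset nbr e c -> #|S| = k.+1 ->
      (#|[set y in nbr e c | S \subset nbr e y]| <= t)%N) ->
    (0 < r)%N -> 0 < nu ->
  (\sum_a #|link e a|)%:R <=
    (t + k + 1)%:R * (2 ^ r)%:R * #|V|%:R ^+ 2
    + k%:R * nu * #|V|%:R ^+ 3 / r%:R + t%:R * #|V|%:R ^+ 2 / nu ^+ k.
Proof.
move=> e_sym codeg r0 nu0; set n := #|V|.
have [W [Wr cover]] :=
  exists_multicover (fun a => setX (nbr e a) (nbr e a)) k r.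
have W2 : (2 ^ #|W| <= 2 ^ r)%N by rewrite leq_exp2l.
have rR : 0 < r%:R :> R by rewrite ltr0n.
pose B : R := (t + k)%:R * (2 ^ r)%:R * n%:R + nu * k%:R * n%:R ^+ 2 / r%:R
  + t%:R * n%:R / nu ^+ k.
have B0 : 0 <= B.
  by rewrite !addr_ge0 ?mulr_ge0 ?invr_ge0 ?exprn_ge0 ?ler0n ?ltW.
have linkB a : #|link e a|%:R <= (a \in W)%:R * n%:R ^+ 2 + B.
  have [aW|aW] := boolP (a \in W).
    rewrite mul1r ler_wpDr // -natrX ler_nat.
    by rewrite (leq_trans (max_card _)) // card_prod.
  rewrite mul0r add0r.
  have -> : #|link e a| = (#|[set p in link e a | (k <= #|probes e W p|)%N]|
       + #|[set p in link e a | (#|probes e W p| < k)%N]|)%N.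
    rewrite -(cardsID [set p | (k <= #|probes e W p|)%N] (link e a)).
    by congr addn; apply: eq_card => p; rewrite !inE // andbC ltnNge.
  rewrite natrD.
  have probed : #|[set p in link e a | (k <= #|probes e W p|)%N]|%:R
      <= t%:R * (2 ^ r)%:R * n%:R :> R.
    rewrite -!natrM ler_nat; apply: leq_trans (card_link_probed e_sym codeg aW) _.
    by rewrite -mulnA [leqRHS]mulnCA (mulnC t) leq_mul.
  have unprobed := card_link_unprobed W a e_sym codeg nu0.
  have uncovered : nu * #|[set p in setX (nbr e a) (nbr e a)
      | (#|probes e W p| < k)%N]|%:R <= nu * k%:R * n%:R ^+ 2 / r%:R.
    rewrite -!(mulrA nu) ler_pM2l // ler_pdivlMr // mulrC -natrX -!natrM ler_nat.
    by have := cover a aW; rewrite card_prod mulnn.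
  have few_classes : (2 ^ #|W| * (k * n))%:R <= k%:R * (2 ^ r)%:R * n%:R :> R.
    by rewrite -!natrM ler_nat -mulnA [leqRHS]mulnCA leq_mul.
  rewrite /B natrD !mulrDl; lra.
rewrite natr_sum; apply: le_trans (ler_sum _ (fun a _ => linkB a)) _.
rewrite big_split /= sumr_const -mulr_suml -natr_sum -big_mkcond /= sum1_card.
have W2R : #|W|%:R <= (2 ^ r)%:R :> R.
  by rewrite ler_nat (leq_trans Wr) // ltnW // ltn_expl.
have : #|W|%:R * n%:R ^+ 2 <= (2 ^ r)%:R * n%:R ^+ 2 :> R.
  by rewrite ler_wpM2r ?exprn_ge0 ?ler0n.
rewrite -[B *+ _]mulr_natr /B -/n !natrD => W_small.
rewrite -subr_ge0; apply: le_trans (_ : 0 <= (2 ^ r)%:R * n%:R ^+ 2 - #|W|%:R * n%:R ^+ 2) _.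
  by rewrite subr_ge0.
rewrite le_eqVlt; apply/orP; left; apply/eqP.
by field; rewrite ?expf_neq0 ?gt_eqF.
Qed.

(** With nu = (r/n)^(1/s), the two main terms of triangle_sum_le have the same
    order X = nu n^3 / r. The term in 2^r is at most 4 X, because
    nu >= 4^(r-1) / n: indeed, as s >= 2, the s-th power of the right-hand side
    is at most its square 16^(r-1) / n^2 <= 1/n. *)
Lemma triangle_sum_le_root (R : realFieldType) (V : finType) (e : rel V)
    (s t r : nat) (nu : R) :
    symmetric e ->
    (forall (c : V) (S : {set V}), S \subset nbr e c -> #|S| = s ->
      (#|[set y in nbr e c | S \subset nbr e y]| <= t)%N) ->
    (2 <= s)%N -> (0 < r)%N -> (16 ^ r.-1 <= #|V|)%N -> 0 < nu ->
    nu ^+ s = r%:R / #|V|%:R ->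
  (\sum_a #|link e a|)%:R <=
    (5 * (s + t))%:R * (nu * #|V|%:R ^+ 3 / r%:R).
Proof.
case: s => // k e_sym codeg k0 r0 rV nu0 nuE; set n := #|V| in rV nuE *.
have n0 : (0 < n)%N by apply: leq_trans rV; rewrite expn_gt0.
have nR : 0 < n%:R :> R by rewrite ltr0n.
have rR : 0 < r%:R :> R by rewrite ltr0n.
have r1 : 1 <= r%:R :> R by rewrite ler1n.
have kst_term : n%:R ^+ 2 / nu ^+ k = nu * n%:R ^+ 3 / r%:R.
  apply/eqP; rewrite eqr_div ?expf_neq0 ?lt0r_neq0 //; apply/eqP.
  have -> : nu * n%:R ^+ 3 * nu ^+ k = nu ^+ k.+1 * n%:R ^+ 3 by rewrite (exprS nu); ring.
  by rewrite nuE; field; rewrite gt_eqF.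
have nu_ge : (4 ^ r.-1)%:R / n%:R <= nu.
  set z := _ / _.
  have z0 : 0 <= z by rewrite divr_ge0.
  have z1 : z <= 1.
    rewrite ler_pdivrMr // mul1r ler_nat (leq_trans _ rV) //.
    by case: (r.-1) => // m; rewrite leq_exp2r.
  rewrite -(@ler_pXn2r _ k.+1) ?nnegrE ?(ltW nu0) // nuE.
  apply: (@le_trans _ _ (z ^+ 2)); first exact: ler_wiXn2l.
  rewrite /z expr_div_n ler_pdivrMr ?exprn_gt0 //.
  rewrite (_ : _ * _ = r%:R * n%:R); last by field; rewrite gt_eqF.
  rewrite -natrX -expnM mulnC expnM -natrM ler_nat.
  by apply: leq_trans rV _; rewrite leq_pmull.
have class_term : (2 ^ r)%:R * n%:R ^+ 2 <= 4 * (nu * n%:R ^+ 3 / r%:R).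
  rewrite mulrA ler_pdivlMr //.
  apply: (@le_trans _ _ (4 * (4 ^ r.-1)%:R * n%:R ^+ 2)).
    rewrite mulrAC ler_wpM2r ?exprn_ge0 // -!natrM ler_nat -expnS prednK //.
    by rewrite (expnMn 2 2) leq_mul // ltnW // ltn_expl.
  rewrite -mulrA ler_wpM2l // (exprS _ 2) mulrA ler_wpM2r ?exprn_ge0 //.
  by move: nu_ge; rewrite ler_pdivrMr.
apply: le_trans (triangle_sum_le e_sym codeg r0 nu0) _; rewrite -/n.
rewrite -!(mulrA t%:R) kst_term.
set X := nu * _ / _ in class_term *.
have X0 : 0 <= X by rewrite divr_ge0 ?mulr_ge0 ?exprn_ge0 ?ltW.
have -> : k%:R * nu * n%:R ^+ 3 / r%:R = k%:R * X by rewrite /X !mulrA.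
have := ler_wpM2l (ler0n R (t + k + 1)) class_term.
rewrite mulrA -addn1 !(natrM, natrD) => class_le.
have tX : 0 <= t%:R * X by rewrite mulr_ge0.
have kX : 0 <= k%:R * X by rewrite mulr_ge0.
lra.
Qed.

(** * From forbidden subgraphs to codegrees *)

Definition adj (V : finType) (G : sgraph V) : rel V :=
  fun x y => [set x; y] \in edges G.

Lemma adj_sym (V : finType) (G : sgraph V) : symmetric (adj G).
Proof. by move=> x y; rewrite /adj setUC. Qed.

Lemma adj_neq (V : finType) (G : sgraph V) (x y : V) : adj G x y -> x != y.
Proof. by move/(forall_inP (edgesP G)); rewrite cards2; case: (x != y). Qed.

Lemma subgraph_free_embedding (U V : finType) (q : rel U) (G : sgraph V)
    (f : U -> V) :
    subgraph_free (graph_of_rel q) G -> injective f ->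
  ~ (forall x y, x != y -> q x y -> adj G (f x) (f y)).
Proof.
move=> Gfree f_inj f_hom; pose F := [ffun u => f u].
pose H := graph_of_rel q.
suff : (F @: [set: U], [set F @: (e : {set U}) | e in edges H]) \in copies H G.
  by rewrite (eqP Gfree) in_set0.
rewrite inE; apply/andP; split; last first.
  apply/existsP; exists F; rewrite !eqxx !andbT.
  by apply/injectiveP => x y; rewrite !ffunE; apply: f_inj.
apply/andP; split; last first.
  by apply/forall_inP => e /imsetP[e0 _ ->]; rewrite imsetS ?subsetT.
apply/subsetP => e /imsetP[e0 /imsetP[[x y]]].
rewrite inE /= => /andP[xy qxy] -> ->.
by rewrite imsetU1 imset_set1 !ffunE; apply: f_hom.
Qed.

(** With more than t common neighbours, c, the set S and t of these neighbours
    would be the parts of a copy of K_{1,s,t}; the parts are disjoint because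
    adjacent vertices are distinct. *)
Lemma tripartite_free_codeg (V : finType) (G : sgraph V) (s t : nat) :
    subgraph_free (complete_tripartite 1 s t) G ->
  forall (c : V) (S : {set V}), S \subset nbr (adj G) c -> #|S| = s ->
    (#|[set y in nbr (adj G) c | S \subset nbr (adj G) y]| <= t)%N.
Proof.
move=> Gfree c S /subsetP Sc Ss; rewrite leqNgt; apply/negP => /ltnW.
rewrite -bin_gt0 -cards_draws => /card_gt0P[B].
rewrite inE => /andP[/subsetP Bsub /eqP Bt].
have adjS x : x \in S -> adj G c x by move/Sc; rewrite inE.
have adjB y : y \in B -> adj G c y by move/Bsub; rewrite !inE => /andP[].
have adjSB x y : x \in S -> y \in B -> adj G x y.
  move=> xS /Bsub; rewrite !inE => /andP[_ /subsetP/(_ x xS)].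
  by rewrite inE adj_sym.
pose f (u : 'I_1 + 'I_s + 'I_t) := match u with
  | inl (inl _) => c
  | inl (inr i) => enum_val (cast_ord (esym Ss) i)
  | inr j => enum_val (cast_ord (esym Bt) j) end.
have fS i : f (inl (inr i)) \in S by exact: enum_valP.
have fB j : f (inr j) \in B by exact: enum_valP.
have f_hom x y : tripart x != tripart y -> adj G (f x) (f y).
  case: x y => [[x|x]|x] [[y|y]|y] // _.
  - exact: adjS (fS y).
  - exact: adjB (fB y).
  - by rewrite adj_sym; exact: adjS (fS x).
  - exact: adjSB (fS x) (fB y).
  - by rewrite adj_sym; exact: adjB (fB x).
  - by rewrite adj_sym; exact: adjSB (fS y) (fB x).
apply: (subgraph_free_embedding Gfree (f := f)); last by move=> x y _; exact: f_hom.
move=> x y fxy; have [same|/f_hom/adj_neq] := eqVneq (tripart x) (tripart y);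
  last by rewrite fxy eqxx.
case: x y same fxy => [[x|x]|x] [[y|y]|y] //= _.
- by rewrite !ord1.
- by move/enum_val_inj/cast_ord_inj->.
- by move/enum_val_inj/cast_ord_inj->.
Qed.

(** The right-hand side counts the labelled triangles (a, x, y), and each copy
    of the triangle arises from one of its labellings. *)
Lemma card_triangles_le (V : finType) (G : sgraph V) :
  (#|copies (complete_graph 3) G| <= \sum_a #|link (adj G) a|)%N.
Proof.
pose A := [set q : (V * V) * V | q.1 \in link (adj G) q.2].
have -> : (\sum_a #|link (adj G) a|)%N = #|A|.
  rewrite card_columns; apply: eq_bigr => a _.
  by apply: eq_card => p; rewrite !inE.
pose g (q : (V * V) * V) (i : 'I_3) := nth q.2 [:: q.2; q.1.1; q.1.2] i.
pose h q := (g q @: [set: 'I_3],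
  [set g q @: (e : {set 'I_3}) | e in edges (complete_graph 3)]).
apply: leq_trans (leq_imset_card h A); apply/subset_leq_card/subsetP => P.
rewrite inE => /andP[/andP[/subsetP PG _] /existsP[f /and3P[_ /eqP P1 /eqP P2]]].
have f_adj i j : i != j -> adj G (f i) (f j).
  move=> ij; apply: PG; rewrite P2; apply/imsetP; exists [set i; j].
    by apply/imsetP; exists (i, j); rewrite ?inE ?ij.
  by rewrite imsetU1 imset_set1.
pose q := ((f (inord 1), f (inord 2)), f (inord 0)).
have gf : g q =1 f.
  by case=> [[|[|[|//]]] i3]; rewrite /g /=; congr (f _); apply: val_inj; rewrite /= inordK.
apply/imsetP; exists q.
  by rewrite !inE /= !f_adj // -val_eqE /= !inordK.
rewrite /h [P]surjective_pairing P1 P2; congr pair; first by rewrite (eq_imset _ gf).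
by apply: eq_imset => e; rewrite (eq_imset _ gf).
Qed.

(** * The asymptotic bound *)

Lemma powR_log_le (R : realType) (n r : nat) (b : R) :
    (2 <= n)%N -> (0 < r)%N -> (n < 16 ^ r)%N -> 0 <= b <= 1 ->
  r%:R `^ (- b) <= 4 * ln n%:R `^ (- b) :> R.
Proof.
move=> n2 r0 nr /andP[b0 b1].
have n1 : 1 < n%:R :> R by rewrite ltr1n.
have rR : 0 < r%:R :> R by rewrite ltr0n.
have L0 : 0 < ln n%:R :> R by rewrite ln_gt0.
(* Since 2 <= exp 1, one has n <= 16^r <= exp (4 r). *)
have L_le : ln n%:R <= 4 * r%:R :> R.
  rewrite -ler_expR lnK ?posrE ?(lt_trans ltr01) //.
  apply: (@le_trans _ _ (16 ^ r)%:R); first by rewrite ler_nat ltnW.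
  rewrite expRM_natr natrX lerXn2r ?nnegrE ?expR_ge0 //.
  have e2 : 2 <= sequences.expR 1 :> R by have := @expR_ge1Dx R 1.
  have -> : 16 = 2 ^+ 4 :> R by ring.
  by rewrite -[4]mul1r expRM_natr lerXn2r ?nnegrE ?expR_ge0.
rewrite !powRN ler_pdivlMr ?powR_gt0 // mulrC ler_pdivrMr ?powR_gt0 //.
apply: (@le_trans _ _ ((4 * r%:R) `^ b)).
  by apply: ge0_ler_powR; rewrite ?nnegrE ?mulr_ge0 ?(ltW L0).
rewrite powRM ?ler0n // ler_wpM2r ?powR_ge0 //.
by rewrite -[leRHS]powRr1 // ler_powR // ler1n.
Qed.

Theorem theorem1p1 (R : realType) (s t : nat) (hs : (2 <= s)%N)
    (hst : (s <= t)%N) :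
  exists C : R, 0 < C /\
    forall n : nat, (2 <= n)%N ->
      (turan_ex n (complete_graph 3) (complete_tripartite 1 s t))%:R <=
        C * n%:R `^ (3 - s%:R^-1) * ln n%:R `^ (-1 + s%:R^-1).
Proof.
have s0 : (0 < s)%N by apply: ltn_trans hs.
exists (20 * (s + t)%:R); split; first by rewrite mulr_gt0 // ltr0n addn_gt0 s0.
move=> n n2.
have n0 : (0 < n)%N by apply: ltn_trans n2.
have nR : 0 < n%:R :> R by rewrite ltr0n.
set bound := (_ * _).
have bound0 : 0 <= bound by rewrite !mulr_ge0 ?powR_ge0.
rewrite /turan_ex; apply: (big_ind (fun m : nat => m%:R <= bound)) => //.
  by move=> m m' mB m'B; rewrite /maxn; case: ifP.
move=> G Gfree.
(* The successor ensures r > 0 also for n < 16. *)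
pose r := (trunc_log 16 n).+1.
have rn : (16 ^ r.-1 <= n)%N by apply: trunc_logP.
have nr : (n < 16 ^ r)%N by apply: trunc_log_ltn.
have rR : 0 < r%:R :> R by rewrite ltr0n.
pose nu : R := (r%:R / n%:R) `^ s%:R^-1.
have nu0 : 0 < nu by rewrite powR_gt0 // divr_gt0.
have nuE : nu ^+ s = r%:R / n%:R.
  rewrite -powR_mulrn ?ltW // -powRrM mulVf ?pnatr_eq0 ?gtn_eqF // powRr1 //.
  by rewrite divr_ge0 ?ltW.
apply: le_trans (_ : (\sum_a #|link (adj G) a|)%:R <= _).
  by rewrite ler_nat card_triangles_le.
have := @triangle_sum_le_root R _ (adj G) s t r nu (@adj_sym _ G)
  (tripartite_free_codeg Gfree) hs isT.
rewrite card_ord => /(_ rn nu0 nuE) /le_trans; apply.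
have -> : nu * n%:R ^+ 3 / r%:R = n%:R `^ (3 - s%:R^-1) * r%:R `^ (- (1 - s%:R^-1)).
  rewrite /nu powRM ?invr_ge0 ?ltW // -(powR_inv1 (ltW nR)) -powRrM mulN1r powRN.
  rewrite opprB !powRB ?(gt_eqF nR, gt_eqF rR) ?implybT // powRr1 ?ltW //.
  by rewrite powR_mulrn ?ltW //; field; rewrite !gt_eqF ?powR_gt0.
rewrite /bound (_ : -1 + s%:R^-1 = - (1 - s%:R^-1)); last by ring.
have s_inv : 0 <= 1 - (s%:R^-1 : R) <= 1.
  rewrite subr_ge0 gerBl invr_ge0 ler0n andbT invf_le1 ?ler1n // ltr0n //.
have := powR_log_le n2 (isT : (0 < r)%N) nr s_inv.
move/(ler_wpM2l (powR_ge0 n%:R (3 - s%:R^-1))) => /(ler_wpM2l (ler0n R (5 * (s + t)))).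
move=> /le_trans; apply; rewrite natrM le_eqVlt; apply/orP; left; apply/eqP.
ring.
Qed.
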